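(* There is an absolute constant $\kappa>0$ such that for all reals $\epsilon,\delta>0$, every integer $d\ge 3$, and all positive integers $r\le n$, $$D\Big(n,d,\epsilon,\delta,\frac1r\Big)\ \ge\ \kappa\, 2^{-d/2}\,\epsilon\,\delta^2\,\lambda_d(r)\, n.$$
   Context: A layered directed acyclic graph of depth $d$ has vertex set partitioned into levels $V_0,\dots,V_d$ with all edges from $V_i$ to $V_{i+1}$; $V_0$ are the inputs and $V_d$ the outputs. Let $G$ be a directed acyclic graph with $n$ inputs and $n$ outputs, and let $\epsilon,\delta>0$, $0\le\mu\le1$. $G$ is $(\epsilon,\delta,\mu)$-densely regular if for every integer $k\in[\mu n,n]$ there are probability distributions $\mathcal X,\mathcal Y$ on $k$-element subsets of inputs and outputs respectively such that for every $i$, $\Pr_{X\sim\mathcal X}[i\in X]\le \frac{k}{\delta n}$ and $\Pr_{Y\sim\mathcal Y}[i\in Y]\le\frac{k}{\delta n}$, and the expected maximum number of vertex-disjoint paths from $X$ to $Y$ (for independent $X\sim\mathcal X$, $Y\sim\mathcal Y$) is at least $\epsilon k$. $D(n,d,\epsilon,\delta,\mu)$ is the minimum number of edges of an $(\epsilon,\delta,\mu)$-densely regular layered directed acyclic graph of depth $d$ with $n$ inputs and $n$ outputs. For $f:\mathbb{N}\to\mathbb{N}$, $f^{(i)}$ is $i$-fold composition and $f^*(n)=\min\{i:f^{(i)}(n)\le1\}$; $\lambda_1(n)=\lfloor\sqrt n\rfloor$, $\lambda_2(n)=\lceil\log_2 n\rceil$, $\lambda_d=\lambda_{d-2}^*$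 for $d\ge3$. *)

(* Defs.v *)
From mathcomp Require Import all_boot all_order all_algebra.
From mathcomp Require Import all_classical all_reals all_analysis.
From Stdlib Require Import PeanoNat.

Set Implicit Arguments.
Unset Strict Implicit.
Unset Printing Implicit Defensive.

Import Order.TTheory GRing.Theory Num.Theory.
Local Open Scope ring_scope.

(* The inputs and outputs are designated sets of vertices; they need not be
   all the sources and sinks of the graph. *)
Record io_dag (n : nat) := IODag {
  vertex :> finType;
  edge : rel vertex;
  inputs : {set vertex};
  outputs : {set vertex};
  edge_acyclic : forall x y, edge x y -> ~~ connect edge y x;
  card_inputs : #|inputs| = n;
  card_outputs : #|outputs| = n
}.

Definition num_edges n (G : io_dag n) : nat :=
  #|[set p : G * G | edge p.1 p.2]|.

Definition layered n (d : nat) (G : io_dag n) : Prop :=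
  exists level : G -> 'I_d.+1,
    [/\ forall x y, edge x y -> level y = (level x).+1 :> nat,
        inputs G = [set x | level x == 0%N :> nat] &
        outputs G = [set x | level x == d :> nat]].

(* A path is the nonempty sequence of its vertices. *)
Definition path_between (V : finType) (e : rel V) (A B : {set V})
    (p : seq V) : bool :=
  if p is x :: q then [&& x \in A, path e x q & last x q \in B] else false.

Definition disjoint_paths (V : finType) (e : rel V) (A B : {set V})
    (m : nat) : Prop :=
  exists P : 'I_m -> seq V,
    (forall i, path_between e A B (P i)) /\
    (forall i j, i != j -> [disjoint P i & P j]).

(* The bound loses nothing: disjoint paths have distinct starting points. *)
Definition max_disjoint_paths (V : finType) (e : rel V) (A B : {set V}) : nat :=
  \max_(m < #|V|.+1 | `[< disjoint_paths e A B m >]) m.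

Definition distr_on_subsets (R : realType) (V : finType) (S : {set V})
    (k : nat) (D : {ffun {set V} -> R}) : Prop :=
  [/\ forall A, 0 <= D A,
      \sum_A D A = 1 &
      forall A, D A != 0 -> A \subset S /\ #|A| = k].

Definition densely_regular (R : realType) n (eps delta mu : R)
    (G : io_dag n) : Prop :=
  forall k : nat, mu * n%:R <= k%:R -> (k <= n)%N ->
  exists DX DY : {ffun {set G} -> R},
    [/\ distr_on_subsets (inputs G) k DX,
        distr_on_subsets (outputs G) k DY,
        forall i, i \in inputs G ->
          \sum_(X : {set G} | i \in X) DX X <= k%:R / (delta * n%:R),
        forall i, i \in outputs G ->
          \sum_(Y : {set G} | i \in Y) DY Y <= k%:R / (delta * n%:R) &
        eps * k%:R <=
          \sum_(X : {set G}) \sum_(Y : {set G})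
            DX X * DY Y * (max_disjoint_paths (@edge n G) X Y)%:R].

(* The minimum of a set of natural numbers, taken in the extended reals so
   that it is +oo when there is no such graph (for instance if 1 < eps). *)
Definition min_edges (R : realType) (n d : nat) (eps delta mu : R) : \bar R :=
  ereal_inf [set x : \bar R | exists G : io_dag n,
    [/\ layered d G, densely_regular eps delta mu G &
        x = ((num_edges G)%:R)%:E]].

(* The value 0 when no iterate reaches 1 is a convention; lambda_iter_le1
   shows that it is not used in the definition of lambda. *)
Definition star (f : nat -> nat) (n : nat) : nat :=
  if pselect (exists i, iter i f n <= 1)%N is left h then ex_minn h else 0%N.

(* lambda 0 is a dummy value. For n > 0, up_log 2 n is the ceiling of the
   binary logarithm of n, and up_log 2 0 = 0. *)
Fixpoint lambda (d : nat) : nat -> nat :=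
  match d with
  | 0 => id
  | 1 => Nat.sqrt
  | 2 => up_log 2
  | d'.+2 => star (lambda d')
  end.

Lemma iter_le1 (f : nat -> nat) :
  (forall n, 1 < n -> f n < n)%N ->
  forall n, exists2 i, (i <= n.-1)%N & (iter i f n <= 1)%N.
Proof.
move=> flt; elim/ltn_ind => n IH.
have [n1|n1] := leqP n 1; first by exists 0%N.
have [j jle jit] := IH _ (flt _ n1).
exists j.+1; last by rewrite iterSr.
have := flt _ n1; case: (f n) jle => [|m] /= jle fn.
  by move: jle; rewrite leqn0 => /eqP ->; rewrite -ltnS prednK // ltnW.
by rewrite -ltnS prednK ?(ltnW n1) //; apply: leq_trans fn; rewrite !ltnS.
Qed.

Lemma lambda_lt d n : (0 < d)%N -> (1 < n)%N -> (lambda d n < n)%N.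
Proof.
elim/ltn_ind: d n => -[|[|[|d]]] //= IH n _ n1.
- by apply/ssrnat.ltP; apply: Nat.sqrt_lt_lin; apply/ssrnat.ltP.
- apply: (@leq_ltn_trans n.-1); last by rewrite prednK // ltnW.
  apply: up_log_min => //.
  by rewrite -{1}(prednK (ltnW n1)); apply: ltn_expl.
- have [i ile iit] :=
    iter_le1 (fun m => IH d.+1 (leqnSn _) m isT) n.
  rewrite /star; case: pselect => [h|_]; last by rewrite ltnW.
  case: ex_minnP => m _ /(_ i iit) mi.
  by rewrite -(prednK (ltnW n1)) ltnS (leq_trans mi).
Qed.

Lemma lambda_iter_le1 d n : (0 < d)%N ->
  exists i, (iter i (lambda d) n <= 1)%N.
Proof.
move=> d0; have [i _ ile] := iter_le1 (fun m => @lambda_lt d m d0) n.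
by exists i.
Qed.

(* Main.v *)
Require Import Defs.
From mathcomp Require Import all_boot all_order all_algebra.
From mathcomp Require Import all_classical all_reals all_analysis.
From mathcomp Require Import zify ring lra.
From Stdlib Require PeanoNat.

Import Order.TTheory GRing.Theory Num.Theory.
Local Open Scope ring_scope.

(* A depth d graph is reduced to depth d - 2 by bypassing levels 1 and d - 1.
   Let f = lambda (d - 2), L = lambda d r = f^* (r), and let u_j be the j-th
   iterate of f at r.  For each i with u_(3i+2) >= 2 L^2, which holds for at
   least L / 8 values of i, put t = u_(3i), rho = u_(3i+1), s = u_(3i+3).  On
   levels 1 and d - 1, looking at degrees towards the inputs (resp. outputs),
   - vertices of degree > t are few, so deleting them costs few paths;
   - deleting the vertices of degree in (s, t] costs on average at most
     k / (delta n) paths per incident edge;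
   - bypassing the vertices of degree <= s multiplies the number of edges by
     at most s (by s^2 when d = 3).
   If fewer than eps delta n / 4 edges were of the middle kind, the bypassed
   graph of depth d - 2 would be (eps/2, delta, 1/rho)-densely regular with
   fewer edges than the induction hypothesis permits.  So every i accounts for
   eps delta n / 4 edges, and distinct i account for distinct edges.  Passing
   from eps to eps/2 in each reduction is the source of the factor 2^(-d/2).
   The recursion stops at d = 1, where a path is an edge from X to Y, and at
   d = 2, where one sums the path counts over k = n / 2^j. *)

(** * Iterated logarithms *)

Lemma star_le f u i : (iter i f u <= 1)%N -> (star f u <= i)%N.
Proof.
rewrite /star; case: pselect => [h|//] hi.
by case: ex_minnP => m _; apply.
Qed.

Lemma star_iter_le1 f u : (forall n, 1 < n -> f n < n)%N ->
  (iter (star f u) f u <= 1)%N.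
Proof.
move=> flt; rewrite /star; case: pselect => [h|]; first by case: ex_minnP.
by have [i _ hi] := iter_le1 flt u; case; exists i.
Qed.

Lemma star_shift f u j : (forall n, 1 < n -> f n < n)%N ->
  (star f u <= j + star f (iter j f u))%N.
Proof.
by move=> flt; apply: star_le; rewrite addnC iterD; apply: star_iter_le1.
Qed.

Lemma star_gt0 f u : (forall n, 1 < n -> f n < n)%N ->
  (1 < u)%N -> (0 < star f u)%N.
Proof.
by move=> flt u1; have := star_iter_le1 f u flt; case: (star f u) => //=; lia.
Qed.

(** With a = [star f (f u)], induction gives a^2 <= 2 (f u), hence a^4 <= 8 u, and (1 + a)^2 <= 2 u
    once a >= 3. The growth bound thus passes up the whole [lambda] hierarchy. *)
Lemma star_sq f u : (forall n, 1 < n -> f n < n)%N ->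
  (forall n, f n ^ 2 <= 2 * n)%N -> (star f u ^ 2 <= 2 * u)%N.
Proof.
move=> flt fsq; elim/ltn_ind: u => u IH.
have [u1|u1] := leqP u 1.
  by have /eqP -> : star f u == 0%N by rewrite -leqn0; apply: star_le.
have sh := star_shift f u 1 flt; rewrite /= in sh.
have := IH _ (flt _ u1); have := fsq u.
(* This settles a = 2: there [f u] must be at least 3, so u >= 5 and 3^2 <= 2 u. *)
have f2 : f u = 2 -> (star f (f u) <= 1)%N.
  by move=> ->; apply: star_le => /=; have := flt 2 isT; lia.
move: sh f2; move: (star f (f u)) => a; move: (star f u) (f u) => b v.
rewrite -!mulnn => sh f2 h1 h2.
have [a3|a3] := leqP 3 a.
  have h4 : ((a * a) * (a * a) <= 8 * u)%N by have := leq_mul h2 h2; lia.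
  have h5 : ((1 + a) * 2 <= a * a)%N by nia.
  nia.
have bb : (b * b <= (1 + a) * (1 + a))%N by nia.
case: a a3 sh f2 h2 bb => [|[|[|//]]] _ sh f2 h2 bb; try lia.
Qed.

Lemma lambdaS d : lambda d.+3 = star (lambda d.+1).
Proof. by []. Qed.

Lemma lambda_gt0 d u : (0 < d)%N -> (1 < u)%N -> (0 < lambda d u)%N.
Proof.
case: d => [//|[|[|d]]] _ u1.
- have [_] := PeanoNat.Nat.sqrt_spec u (PeanoNat.Nat.le_0_l u).
  by rewrite /=; case: (Nat.sqrt u) => //=; lia.
- by rewrite /= up_log_gt0.
- by rewrite lambdaS star_gt0 // => n n1; apply: lambda_lt.
Qed.

Lemma sqr_sqrt_le u : (Nat.sqrt u ^ 2 <= u)%N.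
Proof.
rewrite -mulnn; apply/ssrnat.leP.
by have [] := PeanoNat.Nat.sqrt_spec u (PeanoNat.Nat.le_0_l u).
Qed.

Lemma sqr_up_log_le u : (up_log 2 u ^ 2 <= 2 * u)%N.
Proof.
(* The summand 2 is needed at a = 3; it is available because 2^(a-1) < u gives 2^a + 2 <= 2 u. *)
have H a : (a ^ 2 <= 2 ^ a + 2)%N.
  case: a => [|[|[|[|a]]]] //; rewrite -mulnn.
  elim: a => // a; rewrite [(2 ^ a.+1.+4)%N]expnS.
  have := ltn_expl a.+4 (isT : 1 < 2)%N; move: (2 ^ _)%N; nia.
have [u1|u1] := leqP u 1; first by case: u u1 => [|[|]].
have := up_log_gtn (isT : 1 < 2)%N u1; have := H (up_log 2 u).
have : (0 < up_log 2 u)%N by rewrite up_log_gt0.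
by case: (up_log 2 u) => // a _ /=; rewrite [(2 ^ a.+1)%N]expnS; move: (a.+1 ^ 2)%N (2 ^ a)%N; lia.
Qed.

Lemma lambda_sq d u : (0 < d)%N -> (lambda d u ^ 2 <= 2 * u)%N.
Proof.
elim/ltn_ind: d u => -[//|[|[|d]]] IH u _.
- by have := sqr_sqrt_le u; rewrite /=; lia.
- exact: sqr_up_log_le.
- rewrite lambdaS; apply: star_sq => n; first exact: lambda_lt.
  by apply: IH; lia.
Qed.

(** If the j-th iterate were below 2 L^2, two further steps would lead to some w with w^2 < 4 L, and
    a = [star f w] would satisfy a^4 < 16 L. But L <= j + 2 + a with 2 j <= L gives L <= 2 a + 4,
    which is impossible for L >= 32. *)
Lemma iter_large f r j (L := star f r) : (forall n, 1 < n -> f n < n)%N ->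
  (forall n, f n ^ 2 <= 2 * n)%N -> (32 <= L)%N -> (2 * j <= L)%N ->
  (2 * L ^ 2 <= iter j f r)%N.
Proof.
move=> flt fsq L32 jL; rewrite leqNgt; apply/negP => uL.
have := star_shift f r j.+2 flt; rewrite -/L.
have := star_sq f (iter j.+2 f r) flt fsq.
have := fsq (iter j.+1 f r); have := fsq (iter j f r).
rewrite -!iterS; move: uL; rewrite -!mulnn.
move: (iter j f r) (iter j.+1 f r) (iter j.+2 f r) => u v w.
move: (star f w) => a h1 h2 h3 h4 h5.
have hv : (v < 2 * L)%N by nia.
have hw : (w * w < 4 * L)%N by lia.
have ha : ((a * a) * (a * a) < 16 * L)%N by nia.
have : (L <= 2 * a + 4)%N by lia.
have a14 : (14 <= a)%N by lia.
have : (196 <= a * a)%N by nia.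
nia.
Qed.

(** For v = [f t]: applying f to a large t divides it by at least L. *)
Lemma mul_le_of_sq (v t L : nat) :
  (v ^ 2 <= 2 * t -> 2 * L ^ 2 <= t -> v * L <= t)%N.
Proof.
move=> h1 h2; rewrite -leq_sqr expnMn.
apply: leq_trans (leq_mul h1 (leqnn _)) _.
by rewrite mulnAC -mulnn leq_mul2r h2 orbT.
Qed.

Lemma le_of_lt f u : (forall n, 1 < n -> f n < n)%N ->
  (forall n, f n ^ 2 <= 2 * n)%N -> (f u <= u)%N.
Proof.
move=> flt fsq; case: (leqP u 1) => [|/flt/ltnW //].
move=> u1; have := fsq u; rewrite -mulnn.
by case: u u1 => [|[|//]] _; move: (f _) => [|[|v]] //; rewrite mulSn; lia.
Qed.

(* [u (3 * i)], [u (3 * i.+1)] and [u (3 * i).+1] are the degree thresholds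
   t, s and the parameter rho of the depth reduction. *)
Lemma star_schedule f r (L := star f r) (u := fun j => iter j f r) :
  (forall n, 1 < n -> f n < n)%N -> (forall n, f n ^ 2 <= 2 * n)%N ->
  (forall n, 1 < n -> 0 < f n)%N -> (32 <= L)%N ->
  exists2 J, (L <= 8 * J)%N & forall i, (i < J)%N ->
    [/\ 0 < u (3 * i), 0 < u (3 * i).+1, 0 < u (3 * i.+1),
        u (3 * i).+1 * L <= u (3 * i) & u (3 * i.+1) * L <= f (u (3 * i).+1)]%N.
Proof.
(* The largest J such that i < J implies 2 (3 i + 2) <= L, as [iter_large] requires. *)
move=> flt fsq fpos L32; exists ((L + 2) %/ 6)%N; first by lia.
move=> i iJ.
have large j : (j <= 3 * i + 2)%N -> (2 * L ^ 2 <= u j)%N.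
  by move=> ji; apply: iter_large => //; lia.
have large1 j : (j <= 3 * i + 2)%N -> (1 < u j)%N.
  move=> /large; apply: leq_trans.
  by rewrite -mulnn; have := leq_mul L32 L32; lia.
have -> : u (3 * i.+1)%N = f (u (3 * i).+2) by rewrite mulnS addnC addn3.
split.
- by apply/ltnW/large1; lia.
- by apply/ltnW/large1; lia.
- by apply/fpos/large1; lia.
- by apply: mul_le_of_sq; [apply: fsq|apply: large; lia].
- by apply: mul_le_of_sq; [apply: fsq|apply: (large (3 * i).+2); lia].
Qed.

(** * Linkages in stacks of relations *)

Section Stack.
Set Implicit Arguments.
Unset Strict Implicit.
Variable V : finType.
Implicit Types (a : rel V) (e : nat -> rel V) (X Y L : {set V}).

Definition edges a : {set V * V} := [set p | a p.1 p.2].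
Definition indeg a y := #|[set x | a x y]|.
Definition outdeg a x := #|[set y | a x y]|.

Lemma card_edges a : #|edges a| = (\sum_x \sum_y a x y)%N.
Proof.
rewrite -sum1_card pair_big /= big_mkcond /=.
by apply: eq_bigr => p _; rewrite inE; case: (a _ _).
Qed.

Lemma indegE a y : indeg a y = (\sum_x a x y)%N.
Proof.
rewrite /indeg -sum1_card big_mkcond /=.
by apply: eq_bigr => p _; rewrite inE; case: (a _ _).
Qed.

Lemma outdegE a x : outdeg a x = (\sum_y a x y)%N.
Proof.
rewrite /outdeg -sum1_card big_mkcond /=.
by apply: eq_bigr => p _; rewrite inE; case: (a _ _).
Qed.

Lemma sum_indeg a : (\sum_y indeg a y = #|edges a|)%N.
Proof.
by rewrite card_edges exchange_big; apply: eq_bigr => y _; rewrite indegE.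
Qed.

Lemma sum_outdeg a : (\sum_x outdeg a x = #|edges a|)%N.
Proof. by rewrite card_edges; apply: eq_bigr => y _; rewrite outdegE. Qed.

(** Markov's inequality for counting; with g a degree it bounds the number of heavy vertices. *)
Lemma card_gt_mul_le (g : V -> nat) t :
  (#|[set y | t < g y]| * t <= \sum_y g y)%N.
Proof.
rewrite -sum_nat_const [leqRHS](bigID (mem [set y | t < g y]%N)) /=.
apply: leq_trans (leq_addr _ _); apply: leq_sum => y.
by rewrite inE => /ltnW.
Qed.

Definition comp_via L a (b : rel V) : rel V :=
  fun x z => [exists y, [&& y \in L, a x y & b y z]].

Lemma comp_via_le L a b x z : (comp_via L a b x z <= \sum_(y in L) a x y * b y z)%N.
Proof.
rewrite /comp_via; case: existsP => //= -[y /and3P[yL axy byz]].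
by rewrite (bigD1 y) //= axy byz.
Qed.

(** Every pair of the composite arises from an edge (y, z) of [b] and one of at most s predecessors
    of y. *)
Lemma card_comp_indeg L a b s : {in L, forall y, indeg a y <= s}%N ->
  (#|edges (comp_via L a b)| <= s * #|edges b|)%N.
Proof.
move=> Ls; rewrite card_edges.
apply: (@leq_trans (\sum_x \sum_z \sum_(y in L) a x y * b y z)%N).
  by apply: leq_sum => x _; apply: leq_sum => z _; apply: comp_via_le.
under eq_bigr do rewrite exchange_big /=.
rewrite exchange_big /= card_edges big_distrr /= big_mkcond /=.
apply: leq_sum => y _; case: ifP => // yL.
under eq_bigr do rewrite -big_distrr /=.
by rewrite -big_distrl /= -indegE leq_mul2r Ls ?orbT.
Qed.

Lemma card_comp_outdeg L a b s : {in L, forall y, outdeg b y <= s}%N ->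
  (#|edges (comp_via L a b)| <= s * #|edges a|)%N.
Proof.
move=> Ls; rewrite card_edges.
apply: (@leq_trans (\sum_x \sum_z \sum_(y in L) a x y * b y z)%N).
  by apply: leq_sum => x _; apply: leq_sum => z _; apply: comp_via_le.
under eq_bigr do rewrite exchange_big /=.
rewrite card_edges big_distrr /=.
apply: leq_sum => x _; rewrite big_distrr big_mkcond /=.
apply: leq_sum => y _; case: ifP => // yL.
by rewrite -big_distrr /= -outdegE mulnC leq_mul2r Ls ?orbT.
Qed.

(* A graph of depth d is encoded by the relations [e 0], ..., [e d.-1], where
   [e l] holds the edges from level l to level l.+1; all levels share the
   vertex type [V].  Accordingly, paths only have to differ level by level. *)
Definition linkage e d X Y m (P : 'I_m -> nat -> V) : Prop :=
  [/\ forall i, P i 0 \in X, forall i, P i d \in Y,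
      forall i l, (l < d)%N -> e l (P i l) (P i l.+1) &
      forall l, (l <= d)%N -> injective (P^~ l)].

Definition nu e d X Y : nat :=
  \max_(m < #|V|.+1 | `[< exists P : 'I_m -> nat -> V, linkage e d X Y P >]) m.

Lemma linkage_card e d X Y m (P : 'I_m -> nat -> V) :
  linkage e d X Y P -> (m <= #|V|)%N.
Proof. by case=> _ _ _ /(_ 0%N isT)/leq_card; rewrite card_ord. Qed.

Lemma linkage_le_nu e d X Y m (P : 'I_m -> nat -> V) :
  linkage e d X Y P -> (m <= nu e d X Y)%N.
Proof.
move=> lP; have mV : (m < #|V|.+1)%N by rewrite ltnS (linkage_card lP).
apply: (@leq_bigmax_cond _ _ (fun m : 'I__ => m : nat) (Ordinal mV)).
by apply/asboolP; exists P.
Qed.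

Lemma nu_linkage e d X Y :
  exists P : 'I_(nu e d X Y) -> nat -> V, linkage e d X Y P.
Proof.
have: (0 < #|[pred m : 'I_#|V|.+1 |
    `[< exists P : 'I_m -> nat -> V, linkage e d X Y P >]]|)%N.
  apply/card_gt0P; exists ord0; rewrite inE; do 2 apply/asboolP.
  have P : 'I_0 -> nat -> V by case.
  by exists P; split; [case|case|case|move=> l _; case].
move=> /(eq_bigmax_cond (fun m : 'I__ => m : nat)) [m mP].
by rewrite -[X in X = _ -> _]/(nu e d X Y) => ->; move: mP => /asboolP.
Qed.

Lemma nu_le e d X Y b :
  (forall m (P : 'I_m -> nat -> V), linkage e d X Y P -> (m <= b)%N) ->
  (nu e d X Y <= b)%N.
Proof. by move=> h; have [P /h] := nu_linkage e d X Y. Qed.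

(* Level [j.+1] is suppressed; only its vertices in [L] are short-circuited. *)
Definition bypass e j L l : rel V :=
  if (l < j)%N then e l else if l == j then comp_via L (e j) (e j.+1) else e l.+1.

(** In a linkage, the paths that cross level j + 1 inside [L] still form a linkage when that vertex
    is skipped; at most b others are lost. *)
Lemma nu_bypass e d j L X Y b : (j < d)%N ->
  (forall m (P : 'I_m -> nat -> V), linkage e d.+1 X Y P ->
     (#|[set i | P i j.+1 \notin L]| <= b)%N) ->
  (nu e d.+1 X Y <= nu (bypass e j L) d X Y + b)%N.
Proof.
move=> jd hb; apply: nu_le => m P lP; have {}hb := hb _ _ lP.
pose A := [set i | P i j.+1 \in L].
have mA : m = (#|A| + #|[set i | P i j.+1 \notin L]|)%N.
  rewrite -[LHS]card_ord -(cardsC A); congr (_ + _)%N.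
  by apply: eq_card => i; rewrite !inE.
rewrite [m in (m <= _)%N]mA leq_add //.
pose Q (i : 'I_#|A|) l := P (enum_val i) (if (l <= j)%N then l else l.+1).
apply: (@linkage_le_nu _ _ _ _ _ Q).
case: lP => [P0 Pd Pe Pi]; split.
- by move=> i; rewrite /Q leq0n.
- by move=> i; rewrite /Q leqNgt jd.
- move=> i l ld; rewrite /Q /bypass.
  case: (ltngtP l j) => [lj|jl|->].
  + by apply: Pe; lia.
  + by apply: Pe; lia.
  + apply/existsP; exists (P (enum_val i) j.+1).
    have := enum_valP i; rewrite inE => -> /=.
    by rewrite !Pe //; lia.
- move=> l ld i1 i2 /= /Pi; rewrite /Q => h.
  by apply: enum_val_inj; apply: h; case: ifP; lia.
Qed.

(** Edges are collected rather than vertices: a path through a vertex of middle degree uses such an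
    edge with its outer end in the random set, an event of small probability. *)
Definition midin a s t : {set V * V} :=
  [set p | a p.1 p.2 && (s < indeg a p.2 <= t)%N].
Definition midout a s t : {set V * V} :=
  [set p | a p.1 p.2 && (s < outdeg a p.1 <= t)%N].

Lemma card_bad m (T1 T2 : finType) (g1 : 'I_m -> T1)
  (g2 : 'I_m -> T2) (A1 : {set T1}) (A2 : {set T2}) (B : {set 'I_m}) :
  injective g1 -> injective g2 ->
  (forall i, i \in B -> (g1 i \in A1) || (g2 i \in A2)) ->
  (#|B| <= #|A1| + #|A2|)%N.
Proof.
move=> i1 i2 hB; apply: leq_trans (_ : #|g1 @^-1: A1 :|: g2 @^-1: A2| <= _)%N.
  by apply/subset_leq_card/fintype.subsetP => i /hB; rewrite !inE.
rewrite (leq_trans (leq_card_setU _ _)) // leq_add //.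
  rewrite -(card_imset _ i1); apply/subset_leq_card/fintype.subsetP => x.
  by case/imsetP => i; rewrite inE => ? ->.
rewrite -(card_imset _ i2); apply/subset_leq_card/fintype.subsetP => x.
by case/imsetP => i; rewrite inE => ? ->.
Qed.

Definition low_in a s : {set V} := [set y | indeg a y <= s]%N.
Definition low_out a s : {set V} := [set y | outdeg a y <= s]%N.

(** A lost path is charged to its vertex on level 1 if that has degree above t, and otherwise to its
    first edge. Both charges are injective by disjointness. *)
Lemma nu_front e d s t X Y :
  (nu e d.+2 X Y <= nu (bypass e 0 (low_in (e 0%N) s)) d.+1 X Y +
    (#|[set y | t < indeg (e 0%N) y]%N| +
     #|[set p | (p \in midin (e 0%N) s t) && (p.1 \in X)]|))%N.
Proof.
apply: nu_bypass => // m P [P0 Pd Pe Pi].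
apply: (@card_bad _ _ _ (P^~ 1%N) (fun i => (P i 0%N, P i 1%N))).
- exact: (Pi 1%N isT).
- by move=> i j [/(Pi 0%N isT)].
- move=> i; rewrite !inE /= -ltnNge P0 Pe //= => ->.
  by rewrite andbT orbC; case: (leqP _ t).
Qed.

Lemma nu_back e d s t X Y :
  (nu e d.+2 X Y <= nu (bypass e d (low_out (e d.+1) s)) d.+1 X Y +
    (#|[set y | t < outdeg (e d.+1) y]%N| +
     #|[set p | (p \in midout (e d.+1) s t) && (p.2 \in Y)]|))%N.
Proof.
apply: nu_bypass => // m P [P0 Pd Pe Pi].
apply: (@card_bad _ _ _ (P^~ d.+1) (fun i => (P i d.+1, P i d.+2))).
- exact: (Pi d.+1 (leqnSn _)).
- by move=> i j [_ /(Pi d.+2 (leqnn _))].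
- move=> i; rewrite !inE /= -ltnNge Pd Pe //= => ->.
  by rewrite andbT orbC; case: (leqP _ t).
Qed.

Definition stack_size e d : nat := (\sum_(l < d) #|edges (e l)|)%N.

(** A stack of depth D + 3 becomes one of depth D + 1. Once level 1 is suppressed, the original
    level D + 2 has index D + 1 and is suppressed in turn. *)
Definition trim e D s : nat -> rel V :=
  bypass (bypass e 0 (low_in (e 0%N) s)) D (low_out (e D.+2) s).

Lemma card_front e s :
  (#|edges (bypass e 0 (low_in (e 0%N) s) 0)| <= s * #|edges (e 1%N)|)%N.
Proof. by apply: card_comp_indeg => y; rewrite inE. Qed.

Lemma card_back e D s :
  (#|edges (trim e D s D)| <=
     s * #|edges (bypass e 0 (low_in (e 0%N) s) D)|)%N.
Proof.
rewrite /trim /bypass ltnn eqxx.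
by apply: card_comp_outdeg => y; rewrite inE.
Qed.

(** Both compositions act on the single middle relation [e 1], so the factor s is paid twice. *)
Lemma stack_size_trim1 e s :
  (stack_size (trim e 0 s) 1 <= s ^ 2 * stack_size e 3)%N.
Proof.
rewrite /stack_size big_ord1 !big_ord_recl big_ord0 /=.
have h1 := card_back e 0 s; have h2 := card_front e s.
apply: (leq_trans h1); rewrite -mulnn -mulnA leq_mul2l (leq_trans h2) ?orbT //.
by rewrite leq_mul2l -addnCA leq_addr orbT.
Qed.

(** For D > 0 the two compositions produce different relations, and relation l of the result has at
    most s times as many edges as [e l.+1]. *)
Lemma stack_size_trim e D s : (0 < D)%N -> (0 < s)%N ->
  (stack_size (trim e D s) D.+1 <= s * stack_size e D.+3)%N.
Proof.
move=> D0 s0; apply: (@leq_trans (\sum_(l < D.+1) s * #|edges (e l.+1)|)%N).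
  apply: leq_sum => -[l ld] _ /=.
  case: (ltngtP l D) => [lD||->]; last 1 first.
  - by apply: leq_trans (card_back _ _ _) _; case: D D0 ld => //.
  - rewrite /trim {1}/bypass lD.
    case: l {ld} lD => [|l] lD; first exact: card_front.
    exact: leq_pmull.
  - by lia.
rewrite -big_distrr /= leq_mul2l /stack_size; apply/orP; right.
rewrite [leqRHS]big_ord_recr /= [X in (_ <= X + _)%N]big_ord_recl /=.
by rewrite -addnA addnCA leq_addr.
Qed.

End Stack.

(** * Expected linkages *)

Section Expectation.
Set Implicit Arguments.
Unset Strict Implicit.
Variables (R : realType) (V : finType).
Implicit Types (D : {ffun {set V} -> R}) (p : R) (F G : {set V} -> {set V} -> R).

Definition spread p D : Prop :=
  [/\ forall A, 0 <= D A, \sum_A D A = 1 &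
      forall x, \sum_(A : {set V} | x \in A) D A <= p].

Lemma spread_mem p D x : spread p D -> \sum_A D A * (x \in A)%:R <= p.
Proof.
case=> _ _ /(_ x); rewrite big_mkcond /=.
by under eq_bigr do rewrite -mulrb -mulr_natr.
Qed.

Lemma natr_card_sep (T : finType) (A : {set T}) (P : pred T) :
  (#|[set t in A | P t]|)%:R = \sum_(t in A) (P t)%:R :> R.
Proof.
rewrite -sum1_card natr_sum big_mkcond [RHS]big_mkcond /=.
by apply: eq_bigr => t _; rewrite inE; case: (t \in A); case: (P t).
Qed.

Variables (p : R) (DX DY : {ffun {set V} -> R}).
Hypotheses (sX : spread p DX) (sY : spread p DY).

Definition expect F : R := \sum_X \sum_Y DX X * DY Y * F X Y.

Lemma expect_le F G : (forall X Y, F X Y <= G X Y) -> expect F <= expect G.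
Proof.
move=> FG; apply: ler_sum => X _; apply: ler_sum => Y _.
by apply: ler_wpM2l => //; case: sX sY => ? _ _ [? _ _]; rewrite mulr_ge0.
Qed.

Lemma expect_sum (T : finType) (P : pred T) (F : T -> {set V} -> {set V} -> R) :
  expect (fun X Y => \sum_(t | P t) F t X Y) = \sum_(t | P t) expect (F t).
Proof.
rewrite [RHS]exchange_big /=; apply: eq_bigr => X _.
rewrite [RHS]exchange_big /=; apply: eq_bigr => Y _.
by rewrite mulr_sumr.
Qed.

Lemma expect_add F G : expect (fun X Y => F X Y + G X Y) = expect F + expect G.
Proof.
rewrite /expect -big_split; apply: eq_bigr => X _; rewrite -big_split.
by apply: eq_bigr => Y _; rewrite mulrDr.
Qed.

Lemma expect_sep (g h : {set V} -> R) :
  expect (fun X Y => g X * h Y) = (\sum_X DX X * g X) * (\sum_Y DY Y * h Y).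
Proof.
rewrite big_distrlr; apply: eq_bigr => X _; apply: eq_bigr => Y _.
by rewrite mulrACA.
Qed.

Lemma spread_total D : spread p D -> \sum_X D X * 1 = 1.
Proof. by case=> _ + _; under [in X in _ -> X]eq_bigr do rewrite mulr1. Qed.

Lemma expect_const c : expect (fun _ _ => c) = c.
Proof.
have [[_ hX _] [_ hY _]] := (sX, sY).
rewrite /expect; under eq_bigr do rewrite -mulr_suml -mulr_sumr hY mulr1.
by rewrite -mulr_suml hX mul1r.
Qed.

Lemma expect_left g : expect (fun X _ => g X) = \sum_X DX X * g X.
Proof.
rewrite -[RHS]mulr1 -(spread_total sY) -expect_sep.
by apply: eq_bigr => X _; apply: eq_bigr => Y _; rewrite mulr1.
Qed.

Lemma expect_right h : expect (fun _ Y => h Y) = \sum_Y DY Y * h Y.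
Proof.
rewrite -[RHS]mul1r -(spread_total sX) -expect_sep.
by apply: eq_bigr => X _; apply: eq_bigr => Y _; rewrite mul1r.
Qed.

Lemma expect_memX x : expect (fun X _ => (x \in X)%:R) <= p.
Proof. by rewrite expect_left; apply: spread_mem. Qed.

Lemma expect_memY y : expect (fun _ Y => (y \in Y)%:R) <= p.
Proof. by rewrite expect_right; apply: spread_mem. Qed.

Lemma spread_hit D (a : pred V) : spread p D ->
  0 <= \sum_X D X * (\sum_(x in [set x | a x]) (x \in X)%:R) <=
    #|[set x | a x]|%:R * p.
Proof.
move=> sD; apply/andP; split.
  by apply: sumr_ge0 => X _; rewrite mulr_ge0 ?sumr_ge0 //; case: sD.
under eq_bigr do rewrite mulr_sumr.
rewrite exchange_big /= mulr_natl -sumr_const; apply: ler_sum => x _.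
exact: spread_mem.
Qed.

Lemma expect_nu_le_edges e d :
  expect (fun X Y => (nu e d.+1 X Y)%:R) <= #|edges (e 0%N)|%:R.
Proof.
rewrite -[leRHS]expect_const; apply: expect_le => X Y; rewrite ler_nat.
apply: nu_le => m P [_ _ Pe /(_ 0%N isT) Pi].
have Qi : injective (fun i => (P i 0%N, P i 1%N)) by move=> i j [/Pi].
rewrite -[m]card_ord -(card_imset _ Qi); apply/subset_leq_card.
by apply/fintype.subsetP => _ /imsetP[i _ ->]; rewrite inE Pe.
Qed.

(** Paths of length 1 are distinct edges from X to Y, and by independence a given edge joins X to Y
    with probability at most p^2. *)
Lemma expect_nu1 e :
  expect (fun X Y => (nu e 1 X Y)%:R) <= #|edges (e 0%N)|%:R * p ^+ 2.
Proof.
apply: (@le_trans _ _ (expect (fun X Y =>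
  \sum_(q in edges (e 0%N)) (q.1 \in X)%:R * (q.2 \in Y)%:R))).
  apply: expect_le => X Y.
  under eq_bigr do rewrite -natrM mulnb.
  rewrite -natr_card_sep ler_nat; apply: nu_le => m P [PX PY Pe /(_ 0%N isT) Pi].
  have Qi : injective (fun i => (P i 0%N, P i 1%N)) by move=> i j [/Pi].
  rewrite -[m]card_ord -(card_imset _ Qi); apply/subset_leq_card.
  by apply/fintype.subsetP => _ /imsetP[i _ ->]; rewrite !inE Pe //= PX PY.
rewrite expect_sum mulr_natl -sumr_const; apply: ler_sum => q _.
rewrite expect_sep expr2; apply: ler_pM; rewrite ?spread_mem //.
  by apply: sumr_ge0 => X _; rewrite mulr_ge0 //; case: sX.
by apply: sumr_ge0 => X _; rewrite mulr_ge0 //; case: sY.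
Qed.

(** Disjoint paths of length 2 have distinct midpoints. Here [g v] is the probability that v has a
    predecessor in X and a successor in Y, estimated by a union bound on each side. *)
Lemma expect_nu2 e : exists2 g : V -> R,
  expect (fun X Y => (nu e 2 X Y)%:R) <= \sum_v g v &
  forall v, g v <= 1 /\
    g v <= (indeg (e 0%N) v)%:R * (outdeg (e 1%N) v)%:R * p ^+ 2.
Proof.
pose hX v (X : {set V}) := [exists x in X, e 0%N x v].
pose hY v (Y : {set V}) := [exists y in Y, e 1%N v y].
exists (fun v => expect (fun X Y => (hX v X && hY v Y)%:R)).
  rewrite -(expect_sum xpredT); apply: expect_le => X Y.
  have -> : \sum_v (hX v X && hY v Y)%:R =
      #|[set v | hX v X && hY v Y]|%:R :> R.
    rewrite -sum1_card natr_sum [RHS]big_mkcond /=.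
    by apply: eq_bigr => v _; rewrite inE; case: (_ && _).
  rewrite ler_nat; apply: nu_le => m P [PX PY Pe /(_ 1%N isT) Pi].
  rewrite -[m]card_ord -(card_imset _ Pi); apply/subset_leq_card.
  apply/fintype.subsetP => _ /imsetP[i _ ->]; rewrite !inE /=; apply/andP; split.
    by apply/existsP; exists (P i 0%N); rewrite PX Pe.
  by apply/existsP; exists (P i 2%N); rewrite PY Pe.
move=> v; split.
  by rewrite -[leRHS]expect_const; apply: expect_le => X Y; rewrite lern1 leq_b1.
apply: (@le_trans _ _ (expect (fun X Y =>
  (\sum_(x in [set x | e 0%N x v]) (x \in X)%:R) *
  (\sum_(y in [set y | e 1%N v y]) (y \in Y)%:R)))).
  apply: expect_le => X Y; rewrite -mulnb natrM.
  have hit (Z : {set V}) (a : pred V) :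
      ([exists x in Z, a x])%:R <= \sum_(x in [set x | a x]) (x \in Z)%:R :> R.
    case: existsP => [[x /andP[xZ ax]]|_]; last by rewrite sumr_ge0.
    by rewrite (bigD1 x) ?inE //= xZ lerDl sumr_ge0.
  by apply: ler_pM => //; apply: hit.
rewrite expect_sep expr2 mulrACA.
have /andP[x0 x1] := spread_hit (fun x => e 0%N x v) sX.
have /andP[y0 y1] := spread_hit (fun x => e 1%N v x) sY.
exact: ler_pM.
Qed.

Lemma expect_trim e d s t :
  expect (fun X Y => (nu e d.+3 X Y)%:R) <=
  expect (fun X Y => (nu (trim e d s) d.+1 X Y)%:R) +
  (#|[set y | t < indeg (e 0%N) y]%N| + #|[set y | t < outdeg (e d.+2) y]%N|)%:R +
  (#|midin (e 0%N) s t| + #|midout (e d.+2) s t|)%:R * p.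
Proof.
set hi := #|[set y | t < indeg _ _]%N|; set ho := #|[set y | t < outdeg _ _]%N|.
apply: (@le_trans _ _ (expect (fun X Y => (nu (trim e d s) d.+1 X Y)%:R +
   (hi + ho)%:R + (\sum_(q in midin (e 0%N) s t) (q.1 \in X)%:R +
    \sum_(q in midout (e d.+2) s t) (q.2 \in Y)%:R)))).
  apply: expect_le => X Y; rewrite -!natr_card_sep -!natrD ler_nat.
  apply: (leq_trans (nu_front e d.+1 s t X Y)); rewrite -/hi.
  have := nu_back (bypass e 0 (low_in (e 0%N) s)) d s t X Y.
  rewrite -/(trim e d s) -/ho.
  set a1 := nu _ _ _ _; set a2 := nu _ _ _ _.
  (* The first bypass leaves the last relation unchanged, so out-degrees are those of the original
     stack. *)
  rewrite -[bypass e 0 (low_in (e 0%N) s) d.+1]/(e d.+2) -/ho.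
  set a3 := #|_|; set a4 := #|_|; lia.
rewrite !expect_add !expect_const lerD2l natrD mulrDl; apply: lerD.
  rewrite (expect_sum _ (fun q X _ => (q.1 \in X)%:R)) mulr_natl -sumr_const.
  by apply: ler_sum => q _; apply: expect_memX.
rewrite (expect_sum _ (fun q _ Y => (q.2 \in Y)%:R)) mulr_natl -sumr_const.
by apply: ler_sum => q _; apply: expect_memY.
Qed.

End Expectation.

(** * Lower bounds *)

Section LowerBound.
Set Implicit Arguments.
Unset Strict Implicit.
Variable R : realType.
Implicit Types (V : finType) (eps delta c : R).

(* Of a distribution on k-subsets only the bound on its marginals, [spread], is
   retained; [n <= r * k] is the condition [k >= mu n] for [mu = 1 / r]. *)
Definition regular V (e : nat -> rel V) d n r eps delta : Prop :=
  forall k, (n <= r * k)%N -> (k <= n)%N ->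
  exists DX DY : {ffun {set V} -> R},
    [/\ spread (k%:R / (delta * n%:R)) DX, spread (k%:R / (delta * n%:R)) DY &
        eps * k%:R <= expect DX DY (fun X Y => (nu e d X Y)%:R)].

(** The bound is uniform in the stack, r and eps, since the depth reduction applies it to a trimmed
    stack with rho and eps / 2. *)
Definition lower_bound d c (f : nat -> nat) : Prop :=
  forall V (e : nat -> rel V) n r eps delta,
    0 < eps -> 0 < delta -> delta <= 1 -> (0 < r)%N -> (r <= n)%N ->
    regular e d n r eps delta ->
    c * eps * delta ^+ 2 * (f r)%:R * n%:R <= (stack_size e d)%:R.

Lemma edges_le_stack_size V (e : nat -> rel V) d l : (l < d)%N ->
  (#|edges (e l)| <= stack_size e d)%N.
Proof.
move=> ld; rewrite /stack_size (bigD1 (Ordinal ld)) //=; exact: leq_addr.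
Qed.

(** The case k = n: disjoint paths have distinct first edges. It disposes of small values of
    [f r]. *)
Lemma regular_trivial V (e : nat -> rel V) d n r eps delta : (0 < r)%N ->
  regular e d.+1 n r eps delta -> eps * n%:R <= (stack_size e d.+1)%:R.
Proof.
move=> r0 /(_ n (leq_pmull _ r0) (leqnn _)) [DX [DY [sX sY h]]].
apply: (le_trans h); apply: (le_trans (expect_nu_le_edges sX sY e d)).
by rewrite ler_nat edges_le_stack_size.
Qed.

(** From eps k <= E (k / (delta n))^2 the number E of edges is at least eps delta^2 n^2 / k, which
    is best for the smallest k. *)
Lemma lower_bound1 : lower_bound 1 (1 / 2) id.
Proof.
move=> V e n r eps delta eps0 delta0 _ r0 rn reg.
have n0 : (0 < n)%N := leq_trans r0 rn.
(* This is the ceiling of n / r, the least admissible size; r <= n gives r k <= 2 n, whence the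
   constant 1 / 2. *)
pose k := (n.-1 %/ r).+1.
have nk : (n <= r * k)%N.
  by rewrite mulnC -(prednK n0); exact: (ltn_ceil _ r0).
have kn : (k <= n)%N by rewrite /k -[leqRHS](prednK n0) ltnS leq_div.
have rk : (r * k <= 2 * n)%N.
  by have := leq_divM n.-1 r; rewrite /k mulnS mulnC; lia.
have [DX [DY [sX sY h]]] := reg k nk kn.
have {h} := le_trans h (expect_nu1 sX sY e).
have -> : stack_size e 1 = #|edges (e 0%N)| by rewrite /stack_size big_ord1.
have k0 : 0 < k%:R :> R by rewrite ltr0n.
have n0' : 0 < n%:R :> R by rewrite ltr0n.
have {}rk : r%:R * k%:R <= 2 * n%:R :> R by rewrite -!natrM ler_nat.
rewrite expr_div_n mulrA ler_pdivlMr ?exprn_gt0 ?mulr_gt0 //.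
move: (k%:R : R) (n%:R : R) (r%:R : R) (#|_|%:R : R) k0 n0' rk (ler0n R r)
  (ler0n R #|edges (e 0%N)|) => {nk kn sX sY DX DY} k' n' r' E k0 n0' rk r0' E0 h.
have h1 : eps * delta ^+ 2 * n' ^+ 2 <= E * k'.
  by rewrite -(ler_pM2r k0); move: h; rewrite exprMn; lra.
rewrite -(ler_pM2r n0').
have := ler_wpM2l r0' h1; have := ler_wpM2l E0 rk; lra.
Qed.

Lemma sum_minr_dyadic (y : R) N : 0 <= y ->
  \sum_(j < N) Num.min (2 ^+ j) (y ^+ 2 / 2 ^+ j) <= 4 * y.
Proof.
move=> y0; pose S n := \sum_(j < n) Num.min (2 ^+ j) (y ^+ 2 / 2 ^+ j).
(* The summand is at most [y ^+ 2 / 2 ^+ j], so adding [2 * y ^+ 2 / 2 ^+ N] to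
   the partial sum gives a nonincreasing quantity; it is at most 4 y when 2 ^+ N
   first reaches y. *)
have [S1 S2] : S N <= 2 ^+ N /\ (y <= 2 ^+ N -> S N + 2 * y ^+ 2 / 2 ^+ N <= 4 * y).
  elim: N => [|n [IH1 IH2]].
    rewrite /S big_ord0 expr0 divr1 add0r; split=> // y1.
    have : 0 <= y * (1 - y) by rewrite mulr_ge0 // subr_ge0.
    by move=> h; nra.
  have SS : S n.+1 = S n + Num.min (2 ^+ n) (y ^+ 2 / 2 ^+ n).
    by rewrite /S big_ord_recr.
  have m1 : Num.min (2 ^+ n) (y ^+ 2 / 2 ^+ n) <= 2 ^+ n by rewrite ge_min lexx.
  have m2 : Num.min (2 ^+ n) (y ^+ 2 / 2 ^+ n) <= y ^+ 2 / 2 ^+ n.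
    by rewrite ge_min lexx orbT.
  have z0 : 0 < 2 ^+ n :> R by rewrite exprn_gt0.
  have S3 : S n.+1 <= 2 ^+ n.+1.
    by rewrite SS [2 ^+ n.+1]exprS mulr_natl mulr2n lerD.
  split=> // yz; have [yz'|yz'] := leP y (2 ^+ n).
    have := IH2 yz'; rewrite SS [2 ^+ n.+1]exprS invfM; set u := y ^+ 2 / 2 ^+ n in m2 *.
    have -> : 2 * y ^+ 2 / 2 ^+ n = 2 * u by rewrite /u mulrA.
    have -> : 2 * y ^+ 2 * (2^-1 * (2 ^+ n)^-1) = u by rewrite /u; field; rewrite ?lt0r_neq0.
    lra.
  have w0 : 0 < 2 ^+ n.+1 :> R by rewrite exprn_gt0.
  have wy : 2 ^+ n.+1 <= 2 * y by rewrite [2 ^+ n.+1]exprS; lra.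
  move: S3 yz w0 wy; set w := 2 ^+ n.+1 => S3 yz w0 wy.
  have : 2 * y ^+ 2 / w <= 3 * y - w by rewrite ler_pdivrMr //; nra.
  lra.
have [yz|yz] := leP y (2 ^+ N); last by rewrite -/(S N); lra.
have := S2 yz; have : 0 <= 2 * y ^+ 2 / 2 ^+ N.
  by rewrite divr_ge0 ?exprn_ge0 ?mulr_ge0 ?sqr_ge0.
by rewrite -/(S N); lra.
Qed.

(** At scale k = n / 2^j, a middle vertex of degrees a and b is hit with probability at most min(1,
    a b (k / (delta n))^2). Multiplication by n / k <= 2 * 2^j turns this into the summand. *)
Lemma regular_dyadic V (e : nat -> rel V) n r j eps delta :
  0 < delta -> (2 ^ j.+1 <= r)%N -> (r <= n)%N ->
  regular e 2 n r eps delta ->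
  eps * n%:R <= 2 * \sum_v Num.min (2 ^+ j)
    ((((indeg (e 0%N) v)%:R + (outdeg (e 1%N) v)%:R) / delta) ^+ 2 / 2 ^+ j).
Proof.
move=> delta0 jr rn reg; pose k := (n %/ 2 ^ j)%N.
have z0 : (0 < 2 ^ j)%N by rewrite expn_gt0.
have j2 : (2 * 2 ^ j <= r)%N by rewrite -expnS.
have kz : (k * 2 ^ j <= n)%N := leq_divM _ _.
have nkz : (n < k.+1 * 2 ^ j)%N := ltn_ceil _ z0.
have k0 : (0 < k)%N by rewrite divn_gt0 //; lia.
have nk2 : (n <= 2 * (k * 2 ^ j))%N by nia.
(* The extra factor 2 in [2 ^ j.+1 <= r] pays for rounding k down. *)
have nk : (n <= r * k)%N by nia.
have kn : (k <= n)%N by nia.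
have n0 : (0 < n)%N by lia.
have [DX [DY [sX sY h]]] := reg k nk kn.
have [g gnu gle] := expect_nu2 sX sY e.
have {gnu}h := le_trans h gnu.
have k0' : 0 < k%:R :> R by rewrite ltr0n.
have n0' : 0 < n%:R :> R by rewrite ltr0n.
have zz0 : 0 < 2 ^+ j :> R by rewrite exprn_gt0.
have {}kz : k%:R * 2 ^+ j <= n%:R :> R by rewrite -natrX -natrM ler_nat.
have {}nk2 : n%:R <= 2 * (k%:R * 2 ^+ j) :> R.
  by rewrite -natrX -!natrM ler_nat.
rewrite -(ler_pM2r k0') mulrAC.
apply: le_trans (ler_wpM2r (ltW n0') h) _.
rewrite mulr_suml mulr_sumr mulr_suml; apply: ler_sum => v _.
have [g1 g2] := gle v; move: g2.
have := ler0n R (indeg (e 0%N) v); have := ler0n R (outdeg (e 1%N) v).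
move: (_%:R : R) (_%:R : R) => b a b0 a0 g2.
rewrite /Num.min; case: ifP => _.
  apply: le_trans (ler_wpM2r (ltW n0') g1) _; lra.
apply: le_trans (ler_wpM2r (ltW n0') g2) _.
have -> : a * b * (k%:R / (delta * n%:R)) ^+ 2 * n%:R =
    (k%:R * 2 ^+ j / n%:R) * (a * b / delta ^+ 2 * k%:R / 2 ^+ j).
  by field; rewrite !lt0r_neq0.
have -> : 2 * (((a + b) / delta) ^+ 2 / 2 ^+ j) * k%:R =
    2 * ((a + b) ^+ 2 / delta ^+ 2 * k%:R / 2 ^+ j).
  by field; rewrite !lt0r_neq0.
apply: ler_pM.
- by rewrite !mulr_ge0 ?invr_ge0 ?ltW.
- by rewrite !mulr_ge0 ?invr_ge0 ?exprn_ge0 // ltW.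
- by rewrite ler_pdivrMr //; lra.
- have d0 := ltW delta0; rewrite !ler_wpM2r ?invr_ge0 ?exprn_ge0 //; nra.
Qed.

(** Each of the N scales j contributes eps n. After exchanging the sums, [sum_minr_dyadic] bounds
    the share of a vertex by 8 times its [y v], and these values add up to the size divided by
    delta. *)
Lemma lower_bound2 : lower_bound 2 (1 / 16) (up_log 2).
Proof.
move=> V e n r eps delta eps0 delta0 delta1 r0 rn reg.
have n0 : 0 < n%:R :> R by rewrite ltr0n (leq_trans r0).
have triv := regular_trivial r0 reg.
have dd : delta ^+ 2 <= delta by rewrite expr2 ler_piMl // ltW.
have [a1|a1] := leqP (up_log 2 r) 1.
  apply: le_trans triv; rewrite -subr_ge0.
  have {}a1 : (up_log 2 r)%:R <= 1 :> R by rewrite lern1.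
  have : delta ^+ 2 * (up_log 2 r)%:R <= 1 * 1.
    by apply: ler_pM; rewrite ?sqr_ge0 //; lra.
  have en : 0 < eps * n%:R by rewrite mulr_gt0.
  set x := _ * _%:R => x1.
  have -> : 1 / 16 * eps * delta ^+ 2 * (up_log 2 r)%:R * n%:R =
    1 / 16 * (eps * n%:R) * x by rewrite /x; ring.
  nra.
have r1 : (1 < r)%N by case: r r0 a1 {rn reg} => [|[|]] //; rewrite up_log1.
pose N := (up_log 2 r).-1.
pose y v := ((indeg (e 0%N) v)%:R + (outdeg (e 1%N) v)%:R) / delta.
have sumy : \sum_v y v = (stack_size e 2)%:R / delta.
  rewrite -mulr_suml big_split /= -!natr_sum sum_indeg sum_outdeg -natrD.
  by rewrite /stack_size !big_ord_recl big_ord0 addn0.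
have h : N%:R * (eps * n%:R) <= 8 * (\sum_v y v).
  rewrite mulr_natl -[N in _ *+ N]card_ord -sumr_const.
  apply: (@le_trans _ _ (\sum_(j < N) 2 * \sum_v
      Num.min (2 ^+ j) (y v ^+ 2 / 2 ^+ j))).
    apply: ler_sum => j _; apply: (regular_dyadic delta0 _ rn reg).
    apply: leq_trans (ltnW (up_log_gtn (isT : (1 < 2)%N) r1)).
    by rewrite leq_pexp2l // -/N.
  rewrite -mulr_sumr exchange_big /= !mulr_sumr; apply: ler_sum => v _.
  have y0 : 0 <= y v by rewrite divr_ge0 ?addr_ge0 // ltW.
  have := sum_minr_dyadic N y0; lra.
move: h; rewrite sumy [8 * _]mulrA ler_pdivlMr //.
have : (up_log 2 r)%:R <= 2 * N%:R :> R.
  by rewrite -natrM ler_nat /N; case: (up_log 2 r) a1 => [|[|a]] //= _; lia.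
move: (_%:R : R) (N%:R : R) (ler0n R (up_log 2 r)) => a N' a0 aN h.
have en : 0 < eps * n%:R by rewrite mulr_gt0.
have h1 : delta ^+ 2 * a <= delta * (2 * N').
  by apply: ler_pM; rewrite ?sqr_ge0.
have := ler_wpM2l (ltW en) h1; lra.
Qed.

(** Heavy vertices number at most eps L n / (4 t) <= eps k / 4, by n <= rho k and rho L <= t. The
    middle edges cost another eps k / 4, so eps k / 2 remains. *)
Lemma regular_trim V (e : nat -> rel V) D n r rho s t L eps delta :
  0 < eps -> 0 < delta -> (rho <= r)%N -> (0 < n)%N -> (0 < t)%N -> (rho * L <= t)%N ->
  (stack_size e D.+3)%:R <= eps / 4 * L%:R * n%:R ->
  (#|midin (e 0%N) s t| + #|midout (e D.+2) s t|)%:R <= eps * delta * n%:R / 4 ->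
  regular e D.+3 n r eps delta -> regular (trim e D s) D.+1 n rho (eps / 2) delta.
Proof.
move=> eps0 delta0 rhor n0 t0 rhoL small mid reg k nk kn.
have nrk : (n <= r * k)%N by apply: leq_trans nk _; rewrite leq_mul2r rhor orbT.
have [DX [DY [sX sY h]]] := reg k nrk kn.
exists DX, DY; split=> //.
have := le_trans h (expect_trim sX sY e D s t).
set hi := #|[set y | t < indeg _ _]%N|; set ho := #|[set y | t < outdeg _ _]%N|.
have heavy : ((hi + ho) * t <= stack_size e D.+3)%N.
  have := card_gt_mul_le (indeg (e 0%N)) t; rewrite sum_indeg -/hi => h1.
  have := card_gt_mul_le (outdeg (e D.+2)) t; rewrite sum_outdeg -/ho => h2.
  rewrite mulnDl /stack_size big_ord_recl big_ord_recr /=.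
  by apply: leq_add => //; apply: leq_trans h2 _; apply: leq_addl.
have n0' : 0 < n%:R :> R by rewrite ltr0n.
have t0' : 0 < t%:R :> R by rewrite ltr0n.
have {}heavy : (hi + ho)%:R <= eps * k%:R / 4.
  rewrite -(ler_pM2r t0') -natrM; apply: le_trans (_ : (stack_size e D.+3)%:R <= _).
    by rewrite ler_nat.
  apply: (le_trans small).
  have : L%:R * n%:R <= k%:R * t%:R :> R.
    rewrite -!natrM ler_nat; apply: leq_trans (leq_mul (leqnn L) nk) _.
    by rewrite mulnA mulnC leq_mul2l mulnC rhoL orbT.
  move=> /(ler_wpM2l (ltW eps0)); lra.
have : (#|midin (e 0%N) s t| + #|midout (e D.+2) s t|)%:R *
    (k%:R / (delta * n%:R)) <= eps * k%:R / 4.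
  have k0 : 0 <= k%:R / (delta * n%:R) by rewrite divr_ge0 ?mulr_ge0 // ltW.
  apply: le_trans (ler_wpM2r k0 mid) _.
  have -> : eps * delta * n%:R / 4 * (k%:R / (delta * n%:R)) = eps * k%:R / 4.
    by field; rewrite !lt0r_neq0.
  by [].
move: heavy; lra.
Qed.

(** The windows (u_(i+1), u_i] are disjoint because u is nonincreasing, so no element is counted
    twice. *)
Lemma card_layers_le (T : finType) (A : pred T) (g : T -> nat) (u : nat -> nat) J :
  (forall i, u i.+1 <= u i)%N ->
  (\sum_(i < J) #|[set p | A p && (u i.+1 < g p <= u i)%N]| <=
    #|[set p | A p && (u J < g p)%N]|)%N.
Proof.
move=> umono; elim: J => [|J IH]; first by rewrite big_ord0.
rewrite big_ord_recr /=; apply: leq_trans (leq_add IH (leqnn _)) _.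
rewrite -cardsUI [X in (_ + X)%N](_ : _ = 0%N) ?addn0; last first.
  apply: eq_card0 => p; rewrite !inE; apply/negP.
  by case/andP=> /andP[_ h] /and3P[_ _]; rewrite leqNgt h.
apply/subset_leq_card/fintype.subsetP => p; rewrite !inE.
case/orP=> [/andP[-> h]|/and3P[-> ->]//].
by rewrite (leq_ltn_trans (umono J) h).
Qed.

(** The last hypothesis, [crit], combines the bound at depth D + 1 with the edge count of [trim],
    which differs for D = 0. If the conclusion failed, each window i < J would hold eps delta n / 4
    middle edges, and L <= 8 J would make the size at least eps delta n L / 32. *)
Lemma lower_bound_star D c (f : nat -> nat) : 0 <= c <= 1 / 32 ->
  (forall u, 1 < u -> f u < u)%N -> (forall u, f u ^ 2 <= 2 * u)%N ->
  (forall u, 1 < u -> 0 < f u)%N ->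
  (forall V (e : nat -> rel V) n s rho L eps delta,
     0 < eps -> 0 < delta -> delta <= 1 -> (0 < s)%N -> (0 < L)%N ->
     (s * L <= f rho)%N -> (0 < rho)%N -> (rho <= n)%N ->
     regular (trim e D s) D.+1 n rho (eps / 2) delta ->
     c * eps * delta ^+ 2 * L%:R * n%:R <= (stack_size e D.+3)%:R) ->
  lower_bound D.+3 c (star f).
Proof.
move=> /andP[c0 c1] flt fsq fpos crit V e n r eps delta eps0 delta0 delta1 r0 rn reg.
have [//|small] := leP _ (stack_size e D.+3)%:R.
set L := star f r in small.
have n0 : 0 < n%:R :> R by rewrite ltr0n (leq_trans r0).
have triv := regular_trivial r0 reg.
have dd : delta ^+ 2 <= delta by rewrite expr2 ler_piMl // ltW.
have ed0 : 0 < eps * delta by rewrite mulr_gt0.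
have en0 : 0 < eps * n%:R by rewrite mulr_gt0.
have le32 : c * eps * delta ^+ 2 * L%:R * n%:R <= eps * delta * n%:R * L%:R / 32.
  have h1 : c * delta ^+ 2 <= 1 / 32 * delta.
    by apply: ler_pM; rewrite ?sqr_ge0.
  have := ler_wpM2r (mulr_ge0 (ltW en0) (ler0n R L)) h1; lra.
have le32' : c * eps * delta ^+ 2 * L%:R * n%:R <= eps * n%:R * L%:R / 32.
  apply: (le_trans le32).
  have := ler_wpM2r (mulr_ge0 (ltW en0) (ler0n R L)) delta1; lra.
(* For smaller L the trivial bound eps n already suffices. *)
have L32 : (32 <= L)%N.
  rewrite -(ler_nat R) -(ler_pM2l en0).
  have := le_lt_trans triv (lt_le_trans small le32'); lra.
have [J J8 sched] := star_schedule f r flt fsq fpos L32.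
pose u j := iter j f r.
have umono j : (u j.+1 <= u j)%N by exact: le_of_lt.
have ur j : (u j <= r)%N by elim: j => // j IH; apply: leq_trans (umono j) IH.
(* Otherwise the trimmed stack is regular at rho = u_(3i+1), and [crit] yields the bound assumed to
   fail. *)
have mid (i : 'I_J) : eps * delta * n%:R / 4 <=
    (#|midin (e 0%N) (u (3 * i.+1)%N) (u (3 * i)%N)| +
     #|midout (e D.+2) (u (3 * i.+1)%N) (u (3 * i)%N)|)%:R.
  have [//|hmid] := leP.
  have [t0 rho0 s0 rhoL sL] := sched i (ltn_ord i).
  have reg' : regular (trim e D (u (3 * i.+1)%N)) D.+1 n (u (3 * i).+1)
      (eps / 2) delta.
    apply: (@regular_trim _ _ _ _ r _ _ (u (3 * i)%N) L) => //; last exact: ltW.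
    - by rewrite -(ltr0n R).
    - apply: ltW; apply: (lt_le_trans small); apply: (le_trans le32').
      have := mulr_ge0 (ltW en0) (ler0n R L); lra.
  suff h : c * eps * delta ^+ 2 * L%:R * n%:R <= (stack_size e D.+3)%:R.
    by move: small; rewrite ltNge h.
  apply: (crit _ _ _ _ _ _ _ _ _ _ _ _ _ sL _ _ reg') => //.
  - exact: leq_trans L32.
  - exact: leq_trans (ur (3 * i).+1) rn.
have sum_mid : (\sum_(i < J) (#|midin (e 0%N) (u (3 * i.+1)%N) (u (3 * i)%N)| +
     #|midout (e D.+2) (u (3 * i.+1)%N) (u (3 * i)%N)|) <= stack_size e D.+3)%N.
  have u3mono i : (u (3 * i.+1) <= u (3 * i))%N.
    rewrite mulnS addnC addn3.
    exact: leq_trans (umono _) (leq_trans (umono _) (umono _)).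
  rewrite big_split /= /stack_size big_ord_recl big_ord_recr /=.
  apply: leq_add; last apply: (@leq_trans #|edges (e D.+2)|); last exact: leq_addl.
    apply: leq_trans (card_layers_le (fun p => e 0%N p.1 p.2)
      (fun p => indeg (e 0%N) p.2) J u3mono) _.
    by apply/subset_leq_card/fintype.subsetP => p; rewrite !inE => /andP[].
  apply: leq_trans (card_layers_le (fun p => e D.+2 p.1 p.2)
    (fun p => outdeg (e D.+2) p.1) J u3mono) _.
  by apply/subset_leq_card/fintype.subsetP => p; rewrite !inE => /andP[].
have : J%:R * (eps * delta * n%:R / 4) <= (stack_size e D.+3)%:R.
  apply: (@le_trans _ _ (\sum_(i < J)
     (#|midin (e 0%N) (u (3 * i.+1)%N) (u (3 * i)%N)| +
     #|midout (e D.+2) (u (3 * i.+1)%N) (u (3 * i)%N)|)%:R)); last first.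
    by rewrite -natr_sum ler_nat.
  by rewrite mulr_natl -[J in _ *+ J]card_ord -sumr_const; apply: ler_sum => i _.
have : L%:R <= 8 * J%:R :> R by rewrite -natrM ler_nat.
move=> /(ler_wpM2l (ltW (mulr_gt0 ed0 n0))) h1 h2.
have := lt_le_trans small le32; lra.
Qed.

End LowerBound.

(** * Layered graphs *)

Section Graph.
Set Implicit Arguments.
Unset Strict Implicit.
Variable R : realType.

(** * Induction on the depth *)

Lemma lower_bound_lambda3 : lower_bound 3 (1 / 64 : R) (lambda 3).
Proof.
rewrite lambdaS; apply: lower_bound_star.
- by apply/andP; split; lra.
- by move=> u; apply: lambda_lt.
- by move=> u; apply: lambda_sq.
- by move=> u; apply: lambda_gt0.
move=> V e n s rho L eps delta eps0 delta0 delta1 s0 L0 sL rho0 rhon.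
have eps20 : 0 < eps / 2 by lra.
move=> /(lower_bound1 eps20 delta0 delta1 rho0 rhon) h.
(* The square root in [lambda 1] pays for the factor s^2, since the depth 1 bound is linear in
   rho. *)
have {sL} sL : (s ^ 2 * L <= rho)%N.
  apply: leq_trans (sqr_sqrt_le rho); apply: leq_trans (_ : (s * L) ^ 2 <= _)%N.
    by rewrite expnMn leq_mul2l -mulnn leq_pmulr ?orbT.
  by rewrite leq_sqr.
have s20 : 0 < (s ^ 2)%:R :> R by rewrite ltr0n expn_gt0 s0.
rewrite -(ler_pM2l s20) -natrM.
apply: (@le_trans _ _ (stack_size (trim e 0 s) 1)%:R); last first.
  by rewrite ler_nat stack_size_trim1.
apply: le_trans h; have {sL} : (s ^ 2)%:R * L%:R <= rho%:R :> R.
  by rewrite -natrM ler_nat.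
have q : 0 <= eps * delta ^+ 2 * n%:R.
  by rewrite !mulr_ge0 ?sqr_ge0 // ltW.
have p : 0 <= (rho%:R : R) by [].
move=> /(ler_wpM2l q) h2; have := mulr_ge0 q p; lra.
Qed.

(** By s L <= [lambda d rho], the bound for the trimmed stack is at least s times the one wanted,
    and trimming multiplies the size by at most s. Halving eps halves c. *)
Lemma lower_bound_lambdaSS d (c : R) : (1 < d)%N -> 0 <= c <= 1 / 16 ->
  lower_bound d c (lambda d) -> lower_bound d.+2 (c / 2) (lambda d.+2).
Proof.
case: d => [|D] // D0 /andP[c0 c1] lb; rewrite lambdaS; apply: lower_bound_star.
- by apply/andP; split; lra.
- by move=> u; apply: lambda_lt.
- by move=> u; apply: lambda_sq.
- by move=> u; apply: lambda_gt0.
move=> V e n s rho L eps delta eps0 delta0 delta1 s0 L0 sL rho0 rhon.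
have eps20 : 0 < eps / 2 by lra.
move=> /(lb _ _ _ _ _ _ eps20 delta0 delta1 rho0 rhon) h.
have s0' : 0 < s%:R :> R by rewrite ltr0n.
rewrite -(ler_pM2l s0') -natrM.
apply: (@le_trans _ _ (stack_size (trim e D s) D.+1)%:R); last first.
  by rewrite ler_nat stack_size_trim.
apply: le_trans h; have {sL} : s%:R * L%:R <= (lambda D.+1 rho)%:R :> R.
  by rewrite -natrM ler_nat.
have q : 0 <= c * eps * delta ^+ 2 * n%:R.
  by rewrite !mulr_ge0 ?sqr_ge0 // ltW.
move=> /(ler_wpM2l q) h2; lra.
Qed.

(** Depths 2 and 3 both start from 1 / 64, and each step of two halves the constant. *)
Lemma lower_bound_lambda d : (1 < d)%N ->
  lower_bound d (1 / 32 / 2 ^+ d./2 : R) (lambda d).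
Proof.
elim/ltn_ind: d => -[|[|[|[|d]]]] // IH _.
- move=> V e n r eps delta eps0 delta0 delta1 r0 rn reg.
  apply: le_trans (lower_bound2 eps0 delta0 delta1 r0 rn reg).
  have q : 0 <= eps * delta ^+ 2 * (up_log 2 r)%:R * n%:R.
    by rewrite !mulr_ge0 ?sqr_ge0 // ltW.
  by rewrite /= expr1; lra.
- have -> : 1 / 32 / 2 ^+ 3./2 = 1 / 64 :> R by rewrite /= expr1; lra.
  exact: lower_bound_lambda3.
have -> : 1 / 32 / 2 ^+ d.+4./2 = 1 / 32 / 2 ^+ d.+2./2 / 2 :> R.
  have -> : d.+4./2 = (d.+2./2).+1 by lia.
  by rewrite exprSr invfM mulrA.
apply: lower_bound_lambdaSS => //; last by apply: IH.
have z0 : 1 <= 2 ^+ d.+2./2 :> R by rewrite exprn_ege1 // ler1n.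
apply/andP; split; first by rewrite divr_ge0 ?exprn_ge0.
by rewrite ler_pdivrMr ?(lt_le_trans ltr01 z0) //; lra.
Qed.

(** * From layered graphs to stacks of relations *)

Definition layer n d (G : io_dag n) (level : G -> 'I_d.+1) (l : nat) : rel G :=
  fun x y => edge x y && (level x == l :> nat).

Section Layered.
Variables (n d : nat) (G : io_dag n) (level : G -> 'I_d.+1).
Hypothesis levelS : forall x y : G, edge x y -> level y = (level x).+1 :> nat.
Hypothesis inputsE : inputs G = [set x | level x == 0%N :> nat].
Hypothesis outputsE : outputs G = [set x | level x == d :> nat].

Lemma stack_size_layer : (stack_size (layer level) d <= num_edges G)%N.
Proof.
rewrite /num_edges -[leqRHS]sum1_card.
rewrite (partition_big (fun p : G * G => level p.1) xpredT) //=.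
rewrite big_ord_recr /=; apply: leq_trans (leq_addr _ _); apply: leq_sum => l _.
rewrite sum1_card; apply/subset_leq_card/fintype.subsetP => p.
by rewrite !inE unfold_in /= inE => /andP[-> /eqP h]; apply/eqP/val_inj.
Qed.

(** Levels rise by one along each edge, so a path from X to Y has exactly d edges and its l-th
    vertex lies on level l. *)
Lemma max_disjoint_paths_le_nu (x0 : G) (X Y : {set G}) :
  X \subset inputs G -> Y \subset outputs G ->
  (max_disjoint_paths (@edge n G) X Y <= nu (layer level) d X Y)%N.
Proof.
move=> /fintype.subsetP XI /fintype.subsetP YO.
apply/bigmax_leqP => -[m mV] /asboolP /= [P [Pp Pd]].
have lev0 x : x \in X -> level x = 0%N :> nat.
  by move=> /XI; rewrite inputsE inE => /eqP.
have levd y : y \in Y -> level y = d :> nat.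
  by move=> /YO; rewrite outputsE inE => /eqP.
have path_level (x : G) q l : path (@edge n G) x q -> (l <= size q)%N ->
    level (nth x (x :: q) l) = (level x + l)%N :> nat.
  elim: q x l => [|y q IH] x [|l] //=; rewrite ?addn0 //.
  move=> /andP[/levelS exy pq] lq.
  rewrite (set_nth_default y) // IH // exy; lia.
have shape i : exists x q, [/\ P i = x :: q, x \in X, path (@edge n G) x q,
    last x q \in Y & size q = d].
  move: (Pp i); case: (P i) => [//|x q] /and3P[xX pq lY].
  exists x, q; split=> //.
  have := path_level x q (size q) pq (leqnn _).
  by rewrite -[nth _ _ _]/(nth x (x :: q) (size (x :: q)).-1) nth_last /= levd // lev0.
(* [x0] is only a default value: each path has d + 1 vertices, and only indices up to d matter. *)
pose Q (i : 'I_m) l := nth x0 (P i) l.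
have Qin i l : (l <= d)%N -> Q i l \in P i.
  move=> ld; have [x [q [Pi _ _ _ sq]]] := shape i.
  by rewrite /Q Pi mem_nth //= sq ltnS.
have Qlev i l : (l <= d)%N -> level (Q i l) = l :> nat.
  move=> ld; have [x [q [Pi xX pq _ sq]]] := shape i.
  by rewrite /Q Pi (set_nth_default x) /= ?sq ?ltnS // path_level ?sq // lev0.
apply: (@linkage_le_nu _ _ _ _ _ _ Q); split.
- by move=> i; have [x [q [Pi xX _ _ _]]] := shape i; rewrite /Q Pi.
- move=> i; have [x [q [Pi _ _ lY sq]]] := shape i.
  by rewrite /Q Pi -sq -[size q]/(size (x :: q)).-1 nth_last.
- move=> i l ld; rewrite /layer Qlev ?eqxx ?andbT; last exact: ltnW.
  have [x [q [Pi _ pq _ sq]]] := shape i.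
  by rewrite /Q Pi /=; move/(pathP x0): pq; apply; rewrite sq.
- move=> l ld i j /= Qij; apply/eqP/negPn/negP => /Pd.
  by move=> /pred0P /(_ (Q i l)) /=; rewrite Qin // Qij Qin.
Qed.

(** For k = n the input marginals sum to n, while each of the n inputs contributes at most 1 /
    delta. *)
Lemma delta_le1 (r : nat) (eps delta : R) : (0 < n)%N -> 0 < delta ->
  densely_regular eps delta r%:R^-1 G -> (0 < r)%N -> delta <= 1.
Proof.
move=> n0 delta0 reg r0.
have [] := reg n _ (leqnn n).
  by rewrite -[leRHS]mul1r ler_wpM2r // invf_le1 ?ltr0n // ler1n.
move=> DX [_ [[D0 D1 Dsupp] _ margin _ _]].
have n0' : 0 < n%:R :> R by rewrite ltr0n.
have : \sum_(x in inputs G) \sum_(X : {set G} | x \in X) DX X <=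
    n%:R * (n%:R / (delta * n%:R)).
  apply: (@le_trans _ _ (\sum_(x in inputs G) n%:R / (delta * n%:R))).
    by apply: ler_sum => x; apply: margin.
  by rewrite sumr_const card_inputs [leRHS]mulr_natl.
have -> : \sum_(x in inputs G) \sum_(X : {set G} | x \in X) DX X =
    \sum_X DX X * n%:R.
  rewrite (exchange_big_dep xpredT) //=; apply: eq_bigr => X _.
  have [->|/Dsupp[/fintype.subsetP XI cX]] := eqVneq (DX X) 0.
    by rewrite mul0r big1.
  rewrite sumr_const -[LHS]mulr_natr; congr (_ * _%:R).
  apply: etrans cX.
  apply: eq_card => x; rewrite unfold_in /= andbC.
  by case: (boolP (x \in X)) => // /XI.
rewrite -mulr_suml D1 mul1r.
have -> : n%:R * (n%:R / (delta * n%:R)) = n%:R / delta.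
  by field; rewrite !lt0r_neq0.
by rewrite ler_pdivlMr // ger_pMr.
Qed.

Lemma regular_layer (r : nat) (eps delta : R) : (0 < n)%N -> 0 < delta ->
  densely_regular eps delta r%:R^-1 G -> (0 < r)%N ->
  regular (layer level) d n r eps delta.
Proof.
move=> n0 delta0 reg r0 k nk kn.
have [x0 _] : exists x0, x0 \in inputs G.
  by apply/card_gt0P; rewrite card_inputs.
have [|DX [DY [[X0 X1 Xs] [Y0 Y1 Ys] mX mY h]]] := reg k _ kn.
  by rewrite ler_pdivrMl ?ltr0n // -natrM ler_nat.
(* The marginal bound extends to all vertices, since those outside [S] have marginal 0. *)
have spr (D : {ffun {set G} -> R}) (S : {set G}) :
    (forall A, D A != 0 -> A \subset S /\ #|A| = k) ->
    (forall x, x \in S -> \sum_(A : {set G} | x \in A) D A <= k%:R / (delta * n%:R)) ->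
    forall x, \sum_(A : {set G} | x \in A) D A <= k%:R / (delta * n%:R).
  move=> Ds mD x; have [/mD//|xS] := boolP (x \in S).
  rewrite big1 ?divr_ge0 ?mulr_ge0 // ?(ltW delta0) // => A xA; apply/eqP/negPn/negP.
  by move=> /Ds[/fintype.subsetP/(_ _ xA)]; rewrite (negbTE xS).
exists DX, DY; split.
- by split=> //; apply: spr Xs mX.
- by split=> //; apply: spr Ys mY.
apply: (le_trans h); apply: ler_sum => X _; apply: ler_sum => Y _.
have [->|/Xs[XI _]] := eqVneq (DX X) 0; first by rewrite !mul0r.
have [->|/Ys[YO _]] := eqVneq (DY Y) 0; first by rewrite !mulr0 !mul0r.
by rewrite ler_wpM2l ?mulr_ge0 // ler_nat max_disjoint_paths_le_nu.
Qed.

End Layered.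
End Graph.

Theorem theorem4p3 (R : realType) :
  exists2 kappa : R, 0 < kappa &
    forall (eps delta : R) (d r n : nat),
      0 < eps -> 0 < delta -> (3 <= d)%N -> (0 < r)%N -> (r <= n)%N ->
      ((kappa * 2 `^ (- (d%:R / 2)) * eps * delta ^+ 2
          * (lambda d r)%:R * n%:R)%:E
        <= min_edges n d eps delta (r%:R^-1))%E.
Proof.
exists (1 / 32); first by lra.
move=> eps delta d r n eps0 delta0 d3 r0 rn.
apply: le_ereal_inf_tmp => _ [G [[level [levS inE' outE]] reg ->]].
have n0 : (0 < n)%N := leq_trans r0 rn.
rewrite lee_fin; apply: (@le_trans _ _ (stack_size (layer level) d)%:R); last first.
  by rewrite ler_nat stack_size_layer.
apply: le_trans (lower_bound_lambda (ltnW d3) eps0 delta0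
  (delta_le1 n0 delta0 reg r0) r0 rn (regular_layer levS inE' outE n0 delta0 reg r0)).
rewrite !ler_wpM2r ?sqr_ge0 ?(ltW eps0) // ler_wpM2l //.
(* [d./2] rounds down, so the real power 2^(-d/2) is at most the inverse of [2 ^+ d./2]. *)
rewrite powRN lef_pV2 ?posrE ?powR_gt0 ?exprn_gt0 // -powR_mulrn //.
apply: ler_powR; first by rewrite ler1n.
rewrite ler_pdivlMr // -natrM ler_nat; lia.
Qed.
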